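(* Let $f=g+\overline{h}:\mathbb{B}\to\mathbb{H}$ be such that the image $f(\mathbb{B})$ is convex, where $g(q)=\sum_{n=0}^{+\infty}q^{n}a_n$ and $h(q)=\sum_{n=0}^{+\infty}q^{n}b_n$ are slice regular functions on $\mathbb{B}$ (with $a_n,b_n\in\mathbb{H}$). Then, for each integer $m\ge1$, the partial sum $$S_{m}(q)=\sum_{n=0}^{m}q^{n}a_n+\overline{\sum_{n=0}^{m}q^{n}b_n}$$ maps $B(0,r_{m})$ into $f(\mathbb{B})$, where $r_1=\frac12$, $r_2=\sqrt{3/8}$, and, for $m\ge3$, $r_m$ is the unique positive solution of the equation $1-r-2r^{m+1}=0$.
   Context: $\mathbb{H}$ denotes the quaternions, $B(q_0,r)=\{q\in\mathbb{H}:|q-q_0|<r\}$, $\mathbb{B}=B(0,1)$, $\mathbb{S}=\{q\in\mathbb{H}:q^2=-1\}$; for $I\in\mathbb{S}$, $\mathbb{C}_I=\mathbb{R}\oplus I\mathbb{R}$ and $\mathbb{B}_I=\mathbb{B}\cap\mathbb{C}_I$. A function $g:\mathbb{B}\to\mathbb{H}$ is (left) slice regular if for every $I\in\mathbb{S}$ the restriction $g_I=g|_{\mathbb{B}_I}$ has continuous partial derivatives and $\frac12\left(\frac{\partial}{\partial x}+I\frac{\partial}{\partial y}\right)g_I(x+yI)=0$ on $\mathbb{B}_I$; equivalently $g(q)=\sum_{n\ge0}q^na_n$ on $\mathbb{B}$ with $a_n\in\mathbb{H}$. The bar denotes quaternionic conjugation. *)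

(* Defs.v *)
From HB Require Import structures.
From mathcomp Require Import all_boot all_order all_algebra.
From mathcomp Require Import all_classical all_reals all_analysis.
From mathcomp Require Import ring lra.

Set Implicit Arguments.
Unset Strict Implicit.
Unset Printing Implicit Defensive.

Import Order.TTheory GRing.Theory Num.Theory.
Import numFieldNormedType.Exports.

Local Open Scope classical_set_scope.
Local Open Scope ring_scope.

(* [Quat t x y z] is the quaternion t + x i + y j + z k. *)
Record quaternion (R : Type) := Quat { qre : R; qi : R; qj : R; qk : R }.

Definition quat_tuple (R : Type) (q : quaternion R) : R * R * R * R :=
  (qre q, qi q, qj q, qk q).

Definition tuple_quat (R : Type) (u : R * R * R * R) : quaternion R :=
  let: (t, x, y, z) := u in Quat t x y z.

Lemma quat_tupleK (R : Type) : cancel (@quat_tuple R) (@tuple_quat R).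
Proof. by case. Qed.

HB.instance Definition _ (R : choiceType) :=
  Choice.copy (quaternion R) (can_type (@quat_tupleK R)).

Section QuaternionAlgebra.
Context {R : realType}.
Local Notation H := (quaternion R).
Implicit Types p q : H.

Definition qzero : H := Quat 0 0 0 0.
Definition qopp q : H := Quat (- qre q) (- qi q) (- qj q) (- qk q).
Definition qadd p q : H :=
  Quat (qre p + qre q) (qi p + qi q) (qj p + qj q) (qk p + qk q).

Fact qaddA : associative qadd.
Proof. by move=> [????] [????] [????]; rewrite /qadd /= !addrA. Qed.
Fact qaddC : commutative qadd.
Proof. by move=> [a b c d] [????]; rewrite /qadd /= (addrC a) (addrC b) (addrC c) (addrC d). Qed.
Fact qadd0 : left_id qzero qadd.
Proof. by move=> [????]; rewrite /qadd /= !add0r. Qed.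
Fact qaddN : left_inverse qzero qopp qadd.
Proof. by move=> [????]; rewrite /qadd /= !addNr. Qed.

HB.instance Definition _ := GRing.isZmodule.Build H qaddA qaddC qadd0 qaddN.

Definition qone : H := Quat 1 0 0 0.
Definition qmul p q : H :=
  Quat (qre p * qre q - qi p * qi q - qj p * qj q - qk p * qk q)
       (qre p * qi q + qi p * qre q + qj p * qk q - qk p * qj q)
       (qre p * qj q - qi p * qk q + qj p * qre q + qk p * qi q)
       (qre p * qk q + qi p * qj q - qj p * qi q + qk p * qre q).

Fact qmulA : associative qmul.
Proof. by move=> [????] [????] [????]; rewrite /qmul /=; congr Quat; ring. Qed.
Fact qmul1q : left_id qone qmul.
Proof. by move=> [????]; rewrite /qmul /=; congr Quat; ring. Qed.
Fact qmulq1 : right_id qone qmul.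
Proof. by move=> [????]; rewrite /qmul /=; congr Quat; ring. Qed.
Fact qmulDl : left_distributive qmul +%R.
Proof. by move=> [????] [????] [????]; congr Quat; rewrite /=; ring. Qed.
Fact qmulDr : right_distributive qmul +%R.
Proof. by move=> [????] [????] [????]; congr Quat; rewrite /=; ring. Qed.
Fact qone_neq0 : qone != 0.
Proof. by apply/eqP => -[] /eqP; rewrite oner_eq0. Qed.

HB.instance Definition _ := GRing.Zmodule_isNzRing.Build H
  qmulA qmul1q qmulq1 qmulDl qmulDr qone_neq0.

Definition qscale (a : R) q : H := Quat (a * qre q) (a * qi q) (a * qj q) (a * qk q).

Fact qscaleA a b q : qscale a (qscale b q) = qscale (a * b) q.
Proof. by rewrite /qscale /= !mulrA. Qed.
Fact qscale1 : left_id 1 qscale.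
Proof. by case=> *; rewrite /qscale /= !mul1r. Qed.
Fact qscaleDr : right_distributive qscale +%R.
Proof. by move=> a [????] [????]; congr Quat; rewrite /= mulrDr. Qed.
Fact qscaleDl q : {morph qscale^~ q : a b / a + b}.
Proof. by move=> a b; congr Quat; rewrite /= mulrDl. Qed.

HB.instance Definition _ := GRing.Zmodule_isLmodule.Build R H
  qscaleA qscale1 qscaleDr qscaleDl.

Fact qscaleAl (a : R) p q : a *: (p * q) = (a *: p) * q.
Proof. by case: p q => [????] [????]; congr Quat; rewrite /=; ring. Qed.
Fact qscaleAr (a : R) p q : a *: (p * q) = p * (a *: q).
Proof. by case: p q => [????] [????]; congr Quat; rewrite /=; ring. Qed.

HB.instance Definition _ := GRing.Lmodule_isLalgebra.Build R H qscaleAl.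
HB.instance Definition _ := GRing.Lalgebra_isAlgebra.Build R H qscaleAr.

Definition qconj q : H := Quat (qre q) (- qi q) (- qj q) (- qk q).

Definition qnorm q : R :=
  Num.sqrt (qre q ^+ 2 + qi q ^+ 2 + qj q ^+ 2 + qk q ^+ 2).

Fact qnormD p q : qnorm (p + q) <= qnorm p + qnorm q.
Proof.
case: p q => [a b c d] [x y z t]; rewrite /qnorm /=.
set A := a ^+ 2 + _ + _ + _; set B := x ^+ 2 + _ + _ + _.
have A0 : 0 <= A by rewrite /A !addr_ge0// sqr_ge0.
have B0 : 0 <= B by rewrite /B !addr_ge0// sqr_ge0.
rewrite -[leRHS]ger0_norm ?addr_ge0 ?sqrtr_ge0// -sqrtr_sqr ler_wsqrtr//.
rewrite [leRHS]sqrrD !sqr_sqrtr// -sqrtrM//.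
have : a * x + b * y + c * z + d * t <= Num.sqrt (A * B).
  apply: le_trans (ler_norm _) _; rewrite -sqrtr_sqr ler_wsqrtr// -subr_ge0.
  have -> : A * B - (a * x + b * y + c * z + d * t) ^+ 2 =
     (a * y - b * x) ^+ 2 + (a * z - c * x) ^+ 2 + (a * t - d * x) ^+ 2 +
     (b * z - c * y) ^+ 2 + (b * t - d * y) ^+ 2 + (c * t - d * z) ^+ 2.
    by rewrite /A /B; ring.
  by rewrite !addr_ge0// sqr_ge0.
by rewrite /A /B; lra.
Qed.
Fact qnormZ (a : R) q : qnorm (a *: q) = `|a| * qnorm q.
Proof.
rewrite /qnorm -sqrtr_sqr -sqrtrM ?sqr_ge0//; congr Num.sqrt.
by rewrite /=; ring.
Qed.
Fact qnorm_eq0 q : qnorm q = 0 -> q = 0.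
Proof.
case: q => a b c d /eqP; rewrite /qnorm /= sqrtr_eq0 => s0.
have /andP[a0 /andP[b0 /andP[c0 d0]]] :
    [&& a ^+ 2 == 0, b ^+ 2 == 0, c ^+ 2 == 0 & d ^+ 2 == 0].
  have := (sqr_ge0 a, sqr_ge0 b, sqr_ge0 c, sqr_ge0 d).
  by move=> [[[? ?] ?] ?]; apply/and4P; split; rewrite eq_le; apply/andP; split; lra.
by move: a0 b0 c0 d0; rewrite !sqrf_eq0 => /eqP-> /eqP-> /eqP-> /eqP->.
Qed.

HB.instance Definition _ := Lmodule_isNormed.Build R H qnormD qnormZ qnorm_eq0.

End QuaternionAlgebra.

Section SliceRegular.
Context {R : realType}.
Local Notation H := (quaternion R).

Definition unit_ball : set H := ball 0 1.

Definition imaginary_unit (I : H) : Prop := I ^+ 2 = -1.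

Definition slice_point (I : H) (z : R * R) : H := z.1%:A + z.2 *: I.

(* The slice B_I is identified with an open disc of R * R, so that the
   partial derivatives of g_I are directional derivatives on R * R.  The values
   of g outside the unit ball are irrelevant. *)
Definition slice_regular (g : H -> H) : Prop :=
  forall I : H, imaginary_unit I ->
  let gI := g \o slice_point I in
  let dx : R * R -> H := 'D_(1, 0) gI in
  let dy : R * R -> H := 'D_(0, 1) gI in
  forall z : R * R, unit_ball (slice_point I z) ->
  [/\ derivable gI z (1, 0) /\ derivable gI z (0, 1),
      {for z, continuous dx} /\ {for z, continuous dy} &
      2^-1 *: (dx z + I * dy z) = 0].

Definition power_sum (a : nat -> H) (m : nat) (q : H) : H :=
  \sum_(0 <= n < m.+1) q ^+ n * a n.

Definition power_series_on_ball (a : nat -> H) (g : H -> H) : Prop :=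
  forall q, unit_ball q -> power_sum a m q @[m --> \oo] --> g q.

Definition is_radius (m : nat) (r : R) : Prop :=
  [/\ m = 1%N -> r = 1 / 2,
      m = 2%N -> r = Num.sqrt (3 / 8) &
      (3 <= m)%N -> unique (fun s : R => 0 < s /\ 1 - s - 2 * s ^+ m.+1 = 0) r].

End SliceRegular.

(* Main.v *)
(**
Rotating q in its own slice by e^{It} multiplies q^n a_n by e^{Int}, so averaging
f against a real kernel 1 + 2 sum_j c_j cos (jt) multiplies the n-th terms of
both series by c_n.  Averaging f over the circle through u = q / r with the
kernel 1 + 2 sum_{1 <= j <= m} r^j cos (jt) therefore gives S_m (q), and r_m is
chosen so that the kernel is positive for r < r_m.

The mean is discretised at the N-th roots of unity of the slice.  This gives
convex combinations of values of f, but only up to an aliasing error of order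
s^N with s < 1, and f(B) need not be closed.  In R^5 = R + H the spans of the
vectors (1, value of f) stabilise along the multiples of some N, so the error is
a combination of N fixed values of f with coefficients of order s^N.  All
weights are at least delta / N, which is eventually larger, so the error is
absorbed by a change of the weights.
*)

Require Import Defs.
From mathcomp Require Import all_boot all_order all_algebra.
From mathcomp Require Import all_classical all_reals all_analysis.
From mathcomp Require Import ring lra zify.

Import Order.TTheory GRing.Theory Num.Theory.
Import numFieldNormedType.Exports.
Local Open Scope classical_set_scope.
Local Open Scope ring_scope.

(** * Absorbing a small error into convex weights *)

(** The spans of the points stabilise along multiples of some [N]. There the error, being o(1/N), is
    a combination of fixed points with coefficients too small to make a weight of size at least
    [delta / N] negative. *)
Lemma exact_weights {R : realType} {d : nat} (x : nat -> nat -> 'rV[R]_d)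
    (p : 'rV[R]_d) (w : nat -> nat -> R) (delta : R) :
  0 < delta ->
  (forall N l k, x (N * l.+1)%N (k * l.+1)%N = x N k) ->
  (forall N k, (0 < N)%N -> delta <= N%:R * w N k) ->
  (forall e, 0 < e -> exists N0, forall N j, (N0 <= N)%N ->
     N%:R * `|(p - \sum_(k < N) w N k *: x N k) 0 j| <= e) ->
  exists N (v : 'I_N -> R), (forall k, 0 <= v k) /\ p = \sum_k v k *: x N k.
Proof.
move=> d0 xl wd cvp.
(* Choose N with the row space of U N of maximal dimension. *)
pose U N := \matrix_(k < N) x N k.
pose rk r := `[< exists N, (0 < N)%N /\ \rank (U N) = r >].
have exr : exists r, rk r by exists (\rank (U 1%N)); apply/asboolP; exists 1%N.
have rkd r : rk r -> (r <= d)%N.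
  by case/asboolP => N [_ <-]; exact: rank_leq_col.
case: (ex_maxnP exr rkd) => r0 /asboolP[N [N0 UN]] rmax.
have idx l k : (k < N -> k * l.+1 < N * l.+1)%N by rewrite ltn_mul2r.
have rowUl l (k : 'I_N) :
    x N k = row (Ordinal (idx l k (ltn_ord k))) (U (N * l.+1)%N).
  by rewrite rowK -(xl N l k).
have subU l : (U N <= U (N * l.+1)%N)%MS.
  by apply/row_subP => k; rewrite rowK (rowUl l) row_sub.
(* Refinement keeps the old rows and the rank is already maximal, so the row space cannot grow. *)
have Usub l : (U (N * l.+1)%N <= U N)%MS.
  have := mxrank_leqif_sup (subU l); rewrite /leqif => -[_ <-].
  rewrite eqn_leq mxrankS //= UN; apply: rmax.
  by apply/asboolP; exists (N * l.+1)%N; rewrite muln_gt0 N0.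
pose M l := (N * l.+1)%N.
pose s l := \sum_(k < M l) w (M l) k *: x (M l) k.
have sU l : (s l <= U N)%MS.
  apply: submx_trans (Usub l).
  have -> : s l = (\row_k w (M l) k) *m U (M l).
    by rewrite mulmx_sum_row /s; apply: eq_bigr => k _; rewrite rowK mxE.
  exact: submxMl.
(* A fixed linear map [P] preserves decay faster than 1/N. With [cokermx] this places [p] in the
   span, with [pinvmx] it bounds coefficients. *)
have small n (P : 'M[R]_(d, n)) e : 0 < e ->
    exists l, (M l)%:R * \sum_k `|((p - s l) *m P) 0 k| <= e.
  move=> e0; pose S := \sum_k \sum_j `|P j k|.
  have S0 : 0 <= S by apply: sumr_ge0 => k _; apply: sumr_ge0.
  have S1 : 0 < S + 1 by rewrite ltr_wpDl.
  have [l Hl] := cvp (e / (S + 1)) (divr_gt0 e0 S1).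
  have lM : (l <= M l)%N by rewrite /M; nia.
  exists l; apply: (@le_trans _ _ (e / (S + 1) * S)); last first.
    by rewrite mulrAC ler_pdivrMr // ler_pM2l // lerDl.
  rewrite /S !mulr_sumr; apply: ler_sum => k _; rewrite mxE.
  apply: (@le_trans _ _ ((M l)%:R * \sum_j `|(p - s l) 0 j * P j k|)).
    by rewrite ler_wpM2l ?ler_norm_sum.
  rewrite !mulr_sumr; apply: ler_sum => j _; rewrite normrM mulrA.
  by rewrite ler_wpM2r // Hl.
(* The cokernel kills [s l], so [p] has the same image as the error, which is arbitrarily small. *)
have pU : (p <= U N)%MS.
  rewrite submxE; apply/eqP/rowP => k; rewrite [RHS]mxE.
  apply/eqP; rewrite -normr_le0; apply/ler_addgt0Pl => e e0; rewrite addr0.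
  have [l Hl] := small _ (cokermx (U N)) e e0.
  apply: le_trans Hl; rewrite mulmxBl.
  have := sU l; rewrite submxE => /eqP ->; rewrite subr0.
  apply: (@le_trans _ _ (\sum_j `|(p *m cokermx (U N)) 0 j|)).
    by rewrite (bigD1 k) //= lerDl sumr_ge0.
  rewrite ler_peMl ?sumr_ge0 // ler1n /M muln_gt0 N0 //.
have [l Hl] := small _ (pinvmx (U N)) delta d0.
have eU : (p - s l <= U N)%MS by rewrite addmx_sub // eqmx_opp.
pose c := (p - s l) *m pinvmx (U N).
have pE : p = s l + \sum_(k < N) c 0 k *: x N k.
  have := mulmxKpV eU; rewrite -/c mulmx_sum_row => E.
  rewrite -[LHS](subrK (s l)) addrC -E; congr (_ + _).
  by apply: eq_bigr => k _; rewrite rowK.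
(* Point [k] of level [N] has index [k * l.+1] at level [M l], so its coefficient is added to the
   weight there. *)
exists (M l), (fun i => w (M l) i + \sum_(k < N | (k * l.+1 == i)%N) c 0 k).
have M0 : (0 < M l)%N by rewrite /M muln_gt0 N0.
split=> [i|].
  rewrite -(@pmulr_rge0 _ (M l)%:R) ?ltr0n // mulrDr.
  rewrite -lerBlDr sub0r -mulrN.
  apply: le_trans (wd (M l) i M0); apply: le_trans Hl.
  rewrite ler_wpM2l // -/c; apply: le_trans (ler_norm _) _.
  rewrite normrN; apply: le_trans (ler_norm_sum _ _ _) _.
  by rewrite [leRHS](bigID (fun k : 'I_N => (k * l.+1)%N == i)) /= lerDl sumr_ge0.
rewrite {1}pE.
under [RHS]eq_bigr => i _ do rewrite scalerDl scaler_suml.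
rewrite big_split /=; congr (_ + _).
rewrite (exchange_big_dep xpredT) //=; apply: eq_bigr => k _.
rewrite (big_pred1 (Ordinal (idx l k (ltn_ord k)))) /=; first by rewrite -(xl N l k).
by move=> i; exact: eq_sym.
Qed.

(** * Quaternions and the circle of a slice *)

Section QuaternionNorm.
Context {R : realType}.
Local Notation H := (quaternion R).
Implicit Types p q : H.

Lemma normqE q : `|q| = qnorm q.
Proof. by []. Qed.

Lemma sqr_normq q :
  `|q| ^+ 2 = qre q ^+ 2 + qi q ^+ 2 + qj q ^+ 2 + qk q ^+ 2.
Proof. by rewrite sqr_sqrtr // !addr_ge0 // sqr_ge0. Qed.

Lemma normqM p q : `|p * q| = `|p| * `|q|.
Proof.
apply/eqP; rewrite -(@eqrXn2 _ 2) ?mulr_ge0 // exprMn !sqr_normq; apply/eqP.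
by case: p q => [????] [????] /=; ring.
Qed.

Lemma normq1 : `|1 : H| = 1.
Proof. by rewrite normqE /qnorm /= expr1n expr0n !addr0 sqrtr1. Qed.

Lemma normqX q n : `|q ^+ n| = `|q| ^+ n.
Proof. by elim: n => [|n IH]; rewrite ?normq1 // !exprS normqM IH. Qed.

Lemma mulq_eq0 p q : (p * q == 0) = (p == 0) || (q == 0).
Proof. by rewrite -normr_eq0 normqM mulf_eq0 !normr_eq0. Qed.

Lemma normq_conj q : `|qconj q| = `|q|.
Proof. by rewrite !normqE /qnorm /= !sqrrN. Qed.

Lemma qconjD p q : qconj (p + q) = qconj p + qconj q.
Proof. by congr Quat; rewrite /= ?opprD. Qed.

Lemma qconjZ (c : R) q : qconj (c *: q) = c *: qconj q.
Proof. by congr Quat; rewrite /= ?mulrN. Qed.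

Lemma qconj_sum (I : Type) (s : seq I) (F : I -> H) :
  qconj (\sum_(i <- s) F i) = \sum_(i <- s) qconj (F i).
Proof.
by apply: (big_morph _ qconjD); congr Quat; rewrite /= oppr0.
Qed.

(** Take the normalised imaginary part, or i if q is real. Commuting with I encodes lying in the
    slice of I, and yields (q e^{It})^n = q^n e^{Int}. *)
Lemma imaginary_unit_comm q : exists I : H, imaginary_unit I /\ GRing.comm q I.
Proof.
have sqN (b c d n : R) : n * (b ^+ 2 + c ^+ 2 + d ^+ 2) = 1 -> 0 <= n ->
    imaginary_unit (Quat 0 (Num.sqrt n * b) (Num.sqrt n * c) (Num.sqrt n * d)).
  move=> E n0; rewrite /imaginary_unit expr2; congr Quat => /=; try by ring.
  transitivity (- (Num.sqrt n ^+ 2 * (b ^+ 2 + c ^+ 2 + d ^+ 2))); first by ring.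
  by rewrite sqr_sqrtr // E.
case: q => [a b c d]; set v := b ^+ 2 + c ^+ 2 + d ^+ 2.
have v0 : 0 <= v by rewrite !addr_ge0 // sqr_ge0.
have [vE|vn0] := eqVneq v 0; last first.
  exists (Quat 0 (Num.sqrt v^-1 * b) (Num.sqrt v^-1 * c) (Num.sqrt v^-1 * d)).
  split; first by apply: sqN; rewrite ?invr_ge0 // mulVf.
  by rewrite /GRing.comm; congr Quat; rewrite /=; ring.
exists (Quat 0 (Num.sqrt 1 * 1) (Num.sqrt 1 * 0) (Num.sqrt 1 * 0)).
split; first by apply: sqN => //; ring.
have [b0 c0 d0] : [/\ b = 0, c = 0 & d = 0].
  have := (sqr_ge0 b, sqr_ge0 c, sqr_ge0 d) => -[[? ?] ?].
  by split; apply/eqP; rewrite -sqrf_eq0 eq_le; apply/andP; split;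
    move: vE; rewrite /v; lra.
by rewrite /GRing.comm b0 c0 d0; congr Quat; rewrite /=; ring.
Qed.

End QuaternionNorm.

Section CircleGroup.
Context {R : realType}.
Local Notation H := (quaternion R).

Definition qcis (I : H) (t : R) : H := (cos t)%:A + sin t *: I.

Definition grid_angle (N k : nat) : R := 2 * pi * (k%:R / N%:R).

Variable I : H.
Hypothesis I_unit : imaginary_unit I.

Lemma qcisD s t : qcis I (s + t) = qcis I s * qcis I t.
Proof.
rewrite /qcis cosD sinD mulrDl !mulrDr -!scalerAl -!scalerAr !mul1r mulr1.
rewrite -expr2 I_unit !scalerA.
rewrite scalerN scalerBl scalerDl.
by rewrite -!addrA; congr (_ + _); rewrite addrC -addrA addrCA.
Qed.

Lemma qcis0 : qcis I 0 = 1.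
Proof. by rewrite /qcis cos0 sin0 scale0r addr0 scale1r. Qed.

Lemma qcisX t n : qcis I t ^+ n = qcis I (t * n%:R).
Proof.
elim: n => [|n IH]; first by rewrite mulr0 qcis0.
by rewrite exprS IH -qcisD -[n.+1]add1n natrD mulrDr mulr1.
Qed.

Lemma qcis2pi n : qcis I (2 * pi * n%:R) = 1.
Proof.
rewrite -qcisX [2 * pi]mulr_natl.
rewrite /qcis -[pi *+ 2]add0r cosD2pi sinD2pi cos0 sin0.
by rewrite scale0r addr0 scale1r expr1n.
Qed.

(** Otherwise e^{Iy} = e^{-Iy}, so 2 sin(y) I = 0, although sin y > 0. *)
Lemma qcis_neq1 y : 0 < y < pi -> qcis I (2 * y) != 1.
Proof.
move=> /sin_gt0_pi s0; apply/eqP => E.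
have : qcis I y = qcis I (- y).
  by rewrite -[RHS]mulr1 -E -qcisD; congr qcis; ring.
rewrite /qcis cosN sinN => /addrI /eqP.
rewrite -subr_eq0 scaleNr opprK -scalerDl scaler_eq0 -mulr2n mulrn_eq0 /=.
rewrite gt_eqF //= => /eqP I0.
by have /eqP := I_unit; rewrite /imaginary_unit I0 expr0n /= eq_sym oppr_eq0 oner_eq0.
Qed.

(** The N-th roots of unity are among the N(l+1)-th ones, the compatibility that [exact_weights]
    asks for. *)
Lemma grid_angle_refine N l k :
  grid_angle (N * l.+1) (k * l.+1) = grid_angle N k.
Proof.
by rewrite /grid_angle !natrM -mulf_div divff ?mulr1 // pnatr_eq0.
Qed.

End CircleGroup.

(** * Positivity of the truncated Poisson kernel *)

Section TrigKernel.
Context {R : realType}.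

Definition trig_kernel (m : nat) (r t : R) : R :=
  1 + 2 * \sum_(1 <= j < m.+1) r ^+ j * cos (t * j%:R).

(* Multiplying by |1 - z|^2, z = r e^{it}, turns the kernel, which is
   Re ((1 + z - 2 z^{m+1}) / (1 - z)), into a polynomial expression. *)
Lemma trig_kernel_closed m (r t : R) :
  trig_kernel m r t * (1 - 2 * r * cos t + r ^+ 2) =
  1 - r ^+ 2 - 2 * r ^+ m.+1 * cos (t * m.+1%:R)
    + 2 * r ^+ m.+2 * cos (t * m%:R).
Proof.
elim: m => [|m IH].
  by rewrite /trig_kernel big_geq // !mulr0 cos0 !mulr1; ring.
have -> : trig_kernel m.+1 r t =
    trig_kernel m r t + 2 * r ^+ m.+1 * cos (t * m.+1%:R).
  by rewrite /trig_kernel big_nat_recr //=; ring.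
rewrite mulrDl IH.
have -> : t * m.+2%:R = t * m.+1%:R + t by rewrite -[m.+2]addn1 natrD; ring.
have -> : t * m%:R = t * m.+1%:R - t by rewrite -[m.+1]addn1 natrD; ring.
rewrite cosB cosD !exprS; ring.
Qed.

Lemma radius_equation_decreasing m (s s' : R) : 0 <= s -> s < s' ->
  1 - s' - 2 * s' ^+ m.+1 < 1 - s - 2 * s ^+ m.+1.
Proof.
move=> s0 ss'.
have : s ^+ m.+1 < s' ^+ m.+1 by rewrite ltrXn2r.
by lra.
Qed.

(** In the closed form the numerator is at least 1 - r^2 - 2r^{m+1} - 2r^{m+2} = (1 + r)(1 - r -
    2r^{m+1}), and the denominator is at most (1 + r)^2. *)
Lemma trig_kernel_ge m (r t : R) : 0 <= r -> 0 <= 1 - r - 2 * r ^+ m.+1 ->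
  (1 - r - 2 * r ^+ m.+1) / (1 + r) <= trig_kernel m r t.
Proof.
move=> r0 phi0; set phi := 1 - r - _ in phi0 *.
have c1 := cos_le1 t; have c2 := cos_geN1 t.
have rm0 : 0 <= r ^+ m.+1 by rewrite exprn_ge0.
have rm0' : 0 <= r ^+ m.+2 by rewrite exprn_ge0.
have r1 : r < 1 \/ r = 1 by move: phi0; rewrite /phi; case: (ltgtP r 1); lra.
have D0 : 0 < 1 - 2 * r * cos t + r ^+ 2.
  case: r1 => r1; last first.
    by move: phi0; rewrite /phi r1 expr1n; lra.
  have : 0 < (1 - r) ^+ 2 by rewrite exprn_gt0 // subr_gt0.
  by nra.
rewrite ler_pdivrMr ?ltr_wpDr // -(ler_pM2l D0).
have -> : (1 - 2 * r * cos t + r ^+ 2) * (trig_kernel m r t * (1 + r)) =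
   (1 + r) * (trig_kernel m r t * (1 - 2 * r * cos t + r ^+ 2)) by ring.
rewrite trig_kernel_closed.
apply: (@le_trans _ _ ((1 + r) * ((1 + r) * phi))).
  have : 1 - 2 * r * cos t + r ^+ 2 <= (1 + r) * (1 + r) by nra.
  by rewrite mulrA => h; rewrite ler_wpM2r.
rewrite ler_wpM2l ?addr_ge0 //.
have a1 : r ^+ m.+1 * cos (t * m.+1%:R) <= r ^+ m.+1.
  by rewrite ler_piMr // cos_le1.
have a2 : - r ^+ m.+2 <= r ^+ m.+2 * cos (t * m%:R).
  by rewrite -mulrN1 ler_wpM2l // cos_geN1.
by rewrite /phi; move: a1 a2; rewrite [r ^+ m.+2]exprS; lra.
Qed.

Lemma radius_exists m : (1 <= m)%N -> exists r : R,
  [/\ is_radius m r, r <= 1 & forall s, 0 < s -> s < r ->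
      exists2 delta, 0 < delta & forall t, delta <= trig_kernel m s t].
Proof.
case: m => [|[|[|m]]] // _.
- exists (1 / 2); split; [by split | by lra |].
  move=> s s0 s1; exists (1 - 2 * s) => [|t]; first by lra.
  rewrite /trig_kernel big_nat1 mulr1 expr1.
  by have := cos_geN1 t; nra.
- exists (Num.sqrt (3 / 8)); split; first by split.
    by rewrite -[leRHS]sqrtr1 ler_wsqrtr //; lra.
  (* Completing the square, the kernel is (1/2 + 2s cos t)^2 + 3/4 - 2s^2; this is where sqrt(3/8)
     comes from. *)
  move=> s s0 s1; exists (3 / 4 - 2 * s ^+ 2) => [|t].
    have : s ^+ 2 < 3 / 8.
      have e0 : 0 <= (3 / 8 : R) by lra.
      by rewrite -[ltRHS](sqr_sqrtr e0) ltrXn2r // ltW.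
    by lra.
  rewrite /trig_kernel big_nat_recr // big_nat1 /= mulr1 expr1.
  have -> : cos (t * 2%:R) = 2 * cos t ^+ 2 - 1.
    by rewrite mulr_natr cos_mulr2n mulr_natl.
  have : 0 <= (1 / 2 + 2 * s * cos t) ^+ 2 by exact: sqr_ge0.
  by lra.
(* The index is now [m.+3], hence the exponent [m.+4]. The sign is reversed so that p(0) <= 0 <=
   p(1). *)
pose p : {poly R} := 'X + 2 *: 'X^(m.+4) - 1.
have pE x : p.[x] = - (1 - x - 2 * x ^+ m.+4).
  by rewrite /p !hornerE; ring.
have [||r /andP[r0 r1]] := @poly_ivt _ p 0 1; rewrite ?ler01 ?pE //.
  by rewrite !expr1n expr0n /= mulr0 !subr0 oppr_le0 ler01 /=; lra.
rewrite /root pE oppr_eq0 => /eqP rE.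
have {}r0 : 0 < r.
  by rewrite lt_neqAle r0 andbT; apply/eqP => E; move: rE; rewrite -E expr0n /=; lra.
exists r; split => //.
  split => // _; split => // s [s0 sE].
  case: (ltgtP r s) => // h.
    by have := radius_equation_decreasing m.+3 r s (ltW r0) h; rewrite rE sE ltxx.
  by have := radius_equation_decreasing m.+3 s r (ltW s0) h; rewrite rE sE ltxx.
move=> s s0 sr.
have := radius_equation_decreasing m.+3 s r (ltW s0) sr; rewrite rE => phi0.
exists ((1 - s - 2 * s ^+ m.+4) / (1 + s)).
  by rewrite divr_gt0 // addr_gt0.
by move=> t; apply: trig_kernel_ge; exact: ltW.
Qed.

End TrigKernel.

(** * Means over roots of unity *)

Section GridMeans.
Context {R : realType}.
Local Notation H := (quaternion R).
Variable I : H.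
Hypothesis I_unit : imaginary_unit I.

Lemma qcis_gridM N k e :
  qcis I (grid_angle N k * e%:R) = qcis I (2 * pi / N%:R) ^+ (e * k).
Proof.
rewrite (qcisX _ I_unit); congr qcis; rewrite /grid_angle natrM.
by rewrite -!mulrA; do 2 congr (_ * _); rewrite mulrCA; congr (_ * _); rewrite mulrC.
Qed.

Lemma qcis_root N : (0 < N)%N -> qcis I (2 * pi / N%:R) ^+ N = 1.
Proof.
move=> N0; rewrite (qcisX _ I_unit) divfK ?pnatr_eq0 -?lt0n //.
by rewrite -[2 * pi]mulr1 (qcis2pi _ I_unit 1).
Qed.

(** If w^e differs from 1, the geometric sum times w^e - 1 is w^{eN} - 1 = 0, and the quaternions
    have no zero divisors. *)
Lemma qcis_grid_sum N e : (0 < N)%N ->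
  \sum_(k < N) qcis I (grid_angle N k * e%:R) = (N * (N %| e))%:R.
Proof.
move=> N0; under eq_bigr => k _ do rewrite qcis_gridM exprM.
have wN := qcis_root N N0; set w := qcis I _ in wN *.
(* A nonzero residue e puts the half angle pi e / N in (0, pi), as [qcis_neq1] requires. *)
have -> : w ^+ e = w ^+ (e %% N).
  by rewrite [in LHS](divn_eq e N) exprD mulnC exprM wN expr1n mul1r.
rewrite /dvdn; have [->|e0] := posnP (e %% N).
  under eq_bigr => k _ do rewrite expr0 expr1n.
  by rewrite sumr_const card_ord muln1.
rewrite muln0.
have w1 : w ^+ (e %% N) != 1.
  have -> : w ^+ (e %% N) = qcis I (2 * (pi * ((e %% N)%:R / N%:R))).
    by rewrite (qcisX _ I_unit); congr qcis; ring.
  apply: (qcis_neq1 _ I_unit); have p0 := pi_gt0 R.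
  by rewrite mulr_gt0 ?divr_gt0 ?ltr0n //= gtr_pMr // ltr_pdivrMr ?ltr0n //
    mul1r ltr_nat ltn_mod.
apply/eqP; have /eqP := subrX1 (w ^+ (e %% N)) N.
by rewrite exprAC wN expr1n subrr eq_sym mulq_eq0 subr_eq0 (negPf w1).
Qed.

Definition grid_weight (m : nat) (r : R) (N k : nat) : R :=
  trig_kernel m r (grid_angle N k) / N%:R.

Lemma qcis_cos t : (2 * cos t)%:A = qcis I t + qcis I (- t).
Proof.
rewrite /qcis cosN sinN scaleNr addrACA subrr addr0 -scalerDl.
by rewrite mulr_natl mulr2n.
Qed.

(* [N.-1 * j] stands for [- j] modulo [N]. *)
Lemma grid_weight_moment m r N n : (0 < N)%N ->
  \sum_(k < N) grid_weight m r N k *: qcis I (grid_angle N k * n%:R) =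
  ((N %| n)%:R + \sum_(1 <= j < m.+1)
     r ^+ j * ((N %| n + j) + (N %| n + N.-1 * j))%N%:R)%:A.
Proof.
move=> N0.
have NR : N%:R != 0 :> R by rewrite pnatr_eq0 -lt0n.
have E k : grid_weight m r N k *: qcis I (grid_angle N k * n%:R) =
    N%:R^-1 *: (qcis I (grid_angle N k * n%:R) + \sum_(1 <= j < m.+1)
      r ^+ j *: (qcis I (grid_angle N k * (n + j)%:R) +
                 qcis I (grid_angle N k * (n + N.-1 * j)%:R))).
  rewrite /grid_weight mulrC -scalerA; congr (_ *: _).
  rewrite /trig_kernel scalerDl scale1r; congr (_ + _).
  rewrite mulr_sumr scaler_suml; apply: eq_bigr => j _.
  rewrite mulrCA -scalerA; congr (_ *: _).
  rewrite -[X in _ *: X]mul1r scalerAl qcis_cos mulrDl -!(qcisD _ I_unit).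
  rewrite !natrD !mulrDr; congr (_ + _); first by rewrite addrC.
  rewrite addrC [LHS](qcisD _ I_unit) [RHS](qcisD _ I_unit); congr (_ * _).
  (* The two angles differ by kj full turns. *)
  rewrite -[LHS]mulr1 -(qcis2pi _ I_unit (k * j)) -(qcisD _ I_unit); congr qcis.
  rewrite /grid_angle !natrM (_ : N.-1%:R = N%:R - 1 :> R).
    by field.
  by rewrite -[in RHS](prednK N0) -natr1 addrK.
under eq_bigr => k _ do rewrite E.
rewrite -scaler_sumr big_split /= exchange_big /= qcis_grid_sum //.
have E2 j : \sum_(k < N) r ^+ j *: (qcis I (grid_angle N k * (n + j)%:R) +
                 qcis I (grid_angle N k * (n + N.-1 * j)%:R)) =
    (N%:R * (r ^+ j * ((N %| n + j) + (N %| n + N.-1 * j))%N%:R))%:A.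
  rewrite -scaler_sumr big_split /= !qcis_grid_sum // -natrD -mulnDr.
  by rewrite -scaler_nat scalerA natrM mulrCA.
under eq_bigr => j _ do rewrite E2.
have -> : (N * (N %| n))%:R = (N%:R * (N %| n)%:R)%:A :> H.
  by rewrite -natrM scaler_nat.
by rewrite -scaler_suml -mulr_sumr -scalerDl -mulrDr scalerA mulKf.
Qed.

(** Since n + j <= 2m < N, a single term survives: the constant one if n = 0, and j = n
    otherwise. *)
Lemma grid_weight_moment_low m r N n : (m.*2 < N)%N -> (n <= m)%N ->
  \sum_(k < N) grid_weight m r N k *: qcis I (grid_angle N k * n%:R) = (r ^+ n)%:A.
Proof.
move=> mN nm; rewrite grid_weight_moment; last by lia.
congr (_ *: _).
have D1 j : (1 <= j < m.+1)%N -> (N %| n + j)%N = false.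
  by move=> jm; apply/negP => /dvdn_leq; lia.
have D2 j : (1 <= j < m.+1)%N -> (N %| n + N.-1 * j)%N = (j == n).
  move=> jm; apply/idP/eqP => [|->]; last first.
    by rewrite -mulSn prednK ?dvdn_mulr //; lia.
  move=> /dvdnP[d E].
  have {}E : (n + N * j = d * N + j)%N.
    by rewrite -E -[in LHS](@prednK N) ?mulSn; lia.
  have : (n + N * j = d * N + j %[mod N])%N by rewrite E.
  by rewrite [(_ * j)%N]mulnC addnC !modnMDl !modn_small; lia.
rewrite big_nat_cond (eq_bigr (fun j => if j == n then r ^+ n else 0)); last first.
  move=> j /andP[jm _]; rewrite D1 // D2 // add0n.
  by case: eqP => [->|_]; rewrite ?mulr1 ?mulr0.
rewrite -big_nat_cond -big_mkcond.
have [->|n0] := posnP n.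
  rewrite dvdn0 big_nat_cond big1 ?addr0 // => j /andP[/andP[j0 _] /eqP j1].
  by rewrite j1 in j0.
rewrite gtnNdvd ?add0r; [|lia|lia].
by rewrite big_nat1_eq n0 ltnS nm.
Qed.

(** Both n + j and n - j lie strictly between 0 and N, so aliasing can start only at n = N - m. *)
Lemma grid_weight_moment_mid m r N n : (m < n)%N -> (n + m < N)%N ->
  \sum_(k < N) grid_weight m r N k *: qcis I (grid_angle N k * n%:R) = 0.
Proof.
move=> mn nN; rewrite grid_weight_moment; last by lia.
rewrite gtnNdvd ?add0r; [|lia|lia].
rewrite big_nat_cond big1 ?scale0r // => j /andP[jm _].
have -> : (N %| n + j)%N = false.
  by apply/negP => /dvdn_leq; lia.
have -> : (N %| n + N.-1 * j)%N = false; last by rewrite mulr0.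
apply/negP => /dvdnP[d E].
have {}E : (n + N * j = d * N + j)%N.
  by rewrite -E -[in LHS](@prednK N) ?mulSn; lia.
have : (n + N * j = d * N + j %[mod N])%N by rewrite E.
by rewrite [(_ * j)%N]mulnC addnC !modnMDl !modn_small; lia.
Qed.

Lemma grid_weight_sum m r N : (m.*2 < N)%N ->
  \sum_(k < N) grid_weight m r N k = 1.
Proof.
move=> mN; have := grid_weight_moment_low m r N 0 mN isT.
under eq_bigr => k _ do rewrite mulr0 (qcis0 I).
rewrite expr0 -scaler_suml => /eqP.
by rewrite -subr_eq0 -scalerBl scaler_eq0 oner_eq0 orbF subr_eq0 => /eqP.
Qed.

Lemma norm_qcis_grid N k : (0 < N)%N -> `|qcis I (grid_angle N k)| = 1.
Proof.
move=> N0; have := qcis_gridM N k 1; rewrite mulr1 mul1n => ->.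
rewrite normqX.
suff -> : `|qcis I (2 * pi / N%:R)| = 1 by rewrite expr1n.
apply/eqP; rewrite -(@pexpr_eq1 _ _ N) //.
by rewrite -normqX qcis_root // normq1.
Qed.

End GridMeans.

(** * Aliasing error *)

Section Aliasing.
Context {R : realType}.
Local Notation H := (quaternion R).

Lemma geometric_sum_le (s : R) n : 0 <= s -> s < 1 ->
  \sum_(i < n) s ^+ i <= (1 - s)^-1.
Proof.
move=> s0 s1; have h : 0 < 1 - s by rewrite subr_gt0.
rewrite -[leRHS]mul1r ler_pdivlMr // mulrC.
have -> : (1 - s) * \sum_(i < n) s ^+ i = 1 - s ^+ n.
  by rewrite -opprB mulNr -subrX1 opprB.
by rewrite gerBl exprn_ge0.
Qed.

(* With q = sqrt s, both factors of N s^N = (N q^N) q^N are controlled. *)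
Lemma geometric_beats_linear (s B e : R) m : 0 <= s -> s < 1 -> 0 <= B -> 0 < e ->
  exists N0, forall N, (N0 <= N)%N -> N%:R * (B * s ^+ (N - m)) <= e.
Proof.
move=> s0 s1 B0 e0; pose q := Num.sqrt s.
have q0 : 0 <= q by exact: sqrtr_ge0.
have q1 : q < 1 by rewrite -sqrtr1 ltr_sqrt.
have h : 0 < 1 - q by rewrite subr_gt0.
(* As q <= 1, the k copies of q^k are dominated by the terms q^i with i < k. *)
have linq k : k%:R * q ^+ k <= (1 - q)^-1.
  apply: le_trans (geometric_sum_le q k q0 q1).
  have -> : k%:R * q ^+ k = \sum_(i < k) q ^+ k.
    by rewrite sumr_const card_ord mulr_natl.
  apply: ler_sum => i _.
  by apply: ler_wiXn2l => //; [exact: ltW | exact/ltnW/ltn_ord].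
pose C := m.+1%:R * B * (1 - q)^-1.
have C0 : 0 <= C by rewrite !mulr_ge0 // invr_ge0 ltW.
have C1 : 0 < C + 1 by rewrite ltr_wpDl.
have : q ^+ n @[n --> \oo] --> (0 : R) by apply: cvg_expr; rewrite ger0_norm.
move=> /cvgr0_norm_lt /(_ _ (divr_gt0 e0 C1))[N1 _ HN1].
exists (N1 + m).+1 => N NN; set k := (N - m)%N.
have Nk : (N <= m.+1 * k)%N by rewrite /k; nia.
apply: (@le_trans _ _ (C * q ^+ k)).
  have -> : s ^+ k = q ^+ k * q ^+ k by rewrite -exprMn -expr2 sqr_sqrtr.
  apply: (@le_trans _ _ ((m.+1 * k)%:R * (B * (q ^+ k * q ^+ k)))).
    by rewrite ler_wpM2r ?ler_nat // !mulr_ge0 // exprn_ge0.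
  rewrite natrM (_ : _ * _ = m.+1%:R * B * q ^+ k * (k%:R * q ^+ k)); last by ring.
  rewrite /C [leRHS]mulrAC.
  by apply: ler_wpM2l (linq k); rewrite !mulr_ge0 // exprn_ge0.
have : q ^+ k <= e / (C + 1).
  apply/ltW; have := HN1 k; rewrite /= ger0_norm ?exprn_ge0 //; apply.
  by rewrite /k; lia.
move=> /(ler_wpM2l C0) /le_trans; apply.
by rewrite mulrCA ger_pMr // ler_pdivrMr // mul1r lerDl.
Qed.

Lemma normq_scalar (c : R) : `|c%:A : H| = `|c|.
Proof. by rewrite normrZ normq1 mulr1. Qed.

Lemma unit_ballP (q : H) : unit_ball q <-> `|q| < 1.
Proof. by rewrite /unit_ball -ball_normE /= sub0r normrN. Qed.

(** At a real t with |u| < t < 1 the partial sums are bounded, hence so are their differences t^n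
    |a_n|; the ratio is s = |u| / t. *)
Lemma power_series_coef_bound (a : nat -> H) (g : H -> H) (u : H) :
  power_series_on_ball a g -> `|u| < 1 ->
  exists A s, [/\ 0 <= A, 0 <= s, s < 1 & forall n, `|u| ^+ n * `|a n| <= A * s ^+ n].
Proof.
move=> gs u1; pose t := (`|u| + 1) / 2.
have u0 := normr_ge0 u.
have t0 : 0 < t by rewrite /t; lra.
have t1 : t < 1 by rewrite /t; lra.
have ut : `|u| < t by rewrite /t; lra.
have tb : unit_ball (t%:A : H) by apply/unit_ballP; rewrite normq_scalar gtr0_norm.
have /cvgP/cvg_seq_bounded/pinfty_ex_gt0[B _ /= HB] := gs _ tb.
have {}HB n : `|power_sum a n t%:A| <= B by exact: HB.
have tE n : `|(t%:A : H) ^+ n * a n| = t ^+ n * `|a n|.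
  by rewrite normqM normqX normq_scalar gtr0_norm.
have B0 : 0 <= B by exact: le_trans (HB 0).
have coef n : t ^+ n * `|a n| <= 2 * B.
  case: n => [|n]; rewrite -tE.
    have := HB 0%N; rewrite /power_sum big_nat1 => h; apply: le_trans h _.
    by rewrite mulr_natl mulr2n lerDl.
  have -> : (t%:A : H) ^+ n.+1 * a n.+1 =
      power_sum a n.+1 t%:A - power_sum a n t%:A.
    by rewrite /power_sum [in RHS]big_nat_recr //= [RHS]addrC addKr.
  by rewrite mulr_natl mulr2n (le_trans (ler_normB _ _)) // lerD.
exists (2 * B), (`|u| / t); split.
- by rewrite mulr_ge0.
- by rewrite divr_ge0 // ltW.
- by rewrite ltr_pdivrMr // mul1r.
move=> n; have -> : `|u| ^+ n * `|a n| = t ^+ n * `|a n| * (`|u| / t) ^+ n.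
  by rewrite mulrAC -exprMn [t * _]mulrC divfK ?gt_eqF.
by rewrite ler_wpM2r // exprn_ge0 // divr_ge0 // ltW.
Qed.

Variable I : H.
Hypothesis I_unit : imaginary_unit I.

Lemma power_sum_grid_mean (a : nat -> H) (u : H) m r N M : GRing.comm u I ->
  \sum_(k < N) grid_weight m r N k *: power_sum a M (u * qcis I (grid_angle N k)) =
  \sum_(0 <= n < M.+1) u ^+ n *
    (\sum_(k < N) grid_weight m r N k *: qcis I (grid_angle N k * n%:R)) * a n.
Proof.
move=> uI; rewrite /power_sum.
under eq_bigr => k _ do rewrite scaler_sumr.
rewrite exchange_big /=; apply: eq_bigr => n _.
rewrite mulr_sumr mulr_suml; apply: eq_bigr => k _.
rewrite exprMn_comm; last first.
  rewrite /GRing.comm /qcis mulrDr mulrDl -!scalerAr -!scalerAl mulr1 mul1r.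
  by rewrite uI.
rewrite (qcisX _ I_unit) -[in RHS]scalerAr -[in RHS]scalerAl; reflexivity.
Qed.

(** Degrees up to m give the partial sum at [r *: u], those between m and N - m vanish, and the
    later moments have norm at most 1, leaving a geometric tail. The bound is independent of [M]. *)
Lemma power_sum_aliasing (a : nat -> H) (u : H) m r N M A s :
  GRing.comm u I -> (forall t, 0 <= trig_kernel m r t) ->
  0 <= A -> 0 <= s -> s < 1 ->
  (forall n, `|u| ^+ n * `|a n| <= A * s ^+ n) -> (m.*2 < N)%N -> (N <= M)%N ->
  `|\sum_(k < N) grid_weight m r N k *: power_sum a M (u * qcis I (grid_angle N k))
    - power_sum a m (r *: u)| <= A * (1 - s)^-1 * s ^+ (N - m).
Proof.
move=> uI K0 A0 s0 s1 au mN NM.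
rewrite power_sum_grid_mean //.
rewrite (@big_cat_nat _ _ _ m.+1) //=; [|lia].
rewrite [X in X + _ - _](_ : _ = power_sum a m (r *: u)); last first.
  apply: eq_big_nat => n /andP[_ nm]; rewrite grid_weight_moment_low //.
  by rewrite exprZn -scalerAr mulr1.
rewrite [_ + _ - _]addrC addKr (@big_cat_nat _ _ _ (N - m)%N) //=; [|lia|lia].
rewrite [X in X + _](_ : _ = 0); last first.
  rewrite big_nat_cond big1 // => n /andP[/andP[mn nN] _].
  by rewrite grid_weight_moment_mid ?mulr0 ?mul0r //; lia.
rewrite add0r; apply: le_trans (ler_norm_sum _ _ _) _.
have c1 n : `|\sum_(k < N) grid_weight m r N k *: qcis I (grid_angle N k * n%:R)| <= 1.
  apply: le_trans (ler_norm_sum _ _ _) _.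
  rewrite -[leRHS](grid_weight_sum _ I_unit m r N mN); apply: ler_sum => k _.
  rewrite normrZ -(qcisX _ I_unit) normqX norm_qcis_grid ?expr1n ?mulr1; [|by []|lia].
  by rewrite ger0_norm // /grid_weight divr_ge0.
apply: (@le_trans _ _ (\sum_(N - m <= n < M.+1) A * s ^+ n)).
  apply: ler_sum => n _; rewrite !normqM normqX mulrAC.
  by apply: le_trans (au n); rewrite ler_piMr // mulr_ge0 // exprn_ge0.
rewrite -mulr_sumr -mulrA ler_wpM2l // -{1}[(N - m)%N]add0n big_addn big_mkord.
under eq_bigr => i _ do rewrite exprD.
by rewrite -mulr_suml ler_wpM2r ?exprn_ge0 ?geometric_sum_le.
Qed.

(** For fixed N the aliasing bound passes to the limit in the truncation degree [M]. Its geometric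
    decay absorbs the factor N that [exact_weights] demands. *)
Lemma grid_mean_error (a : nat -> H) (g : H -> H) (u : H) m r :
  power_series_on_ball a g -> GRing.comm u I -> `|u| < 1 ->
  (forall t, 0 <= trig_kernel m r t) ->
  forall e, 0 < e -> exists N0, forall N, (N0 <= N)%N ->
    N%:R * `|\sum_(k < N) grid_weight m r N k *: g (u * qcis I (grid_angle N k))
             - power_sum a m (r *: u)| <= e.
Proof.
move=> gs uI u1 K0 e e0.
have [A [s [A0 s0 s1 au]]] := power_series_coef_bound _ _ _ gs u1.
have B0 : 0 <= A * (1 - s)^-1 by rewrite mulr_ge0 // invr_ge0 subr_ge0 ltW.
have [N1 HN1] := geometric_beats_linear _ _ _ m s0 s1 B0 e0.
exists (N1 + m.*2.+1)%N => N NN.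
apply: le_trans (HN1 N _); last by lia.
rewrite ler_wpM2l //.
set S := power_sum a m _.
have cv : `|\sum_(k < N) grid_weight m r N k *:
            power_sum a M (u * qcis I (grid_angle N k)) - S| @[M --> \oo] -->
    `|\sum_(k < N) grid_weight m r N k *: g (u * qcis I (grid_angle N k)) - S|.
  apply: cvg_norm; apply: cvgB; last exact: cvg_cst.
  apply: cvg_big => [|k _]; first exact: add_continuous.
  apply: cvgZl_tmp; apply: gs; apply/unit_ballP.
  by rewrite normqM norm_qcis_grid ?mulr1 //; lia.
apply: (cvgr_to_le cv); exists N => //= M NM.
by apply: power_sum_aliasing => //; lia.
Qed.

End Aliasing.

(** * Convex combinations of values *)

Section Convexity.
Context {R : realType}.
Local Notation H := (quaternion R).

(** By induction, renormalising the tail weights by their sum [s]; if s = 0 they all vanish. *)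
Lemma convex_set_sum (V : lmodType R) (A : set V) n (v : 'I_n -> R)
    (x : 'I_n -> V) : convex_set A -> (forall i, 0 <= v i) ->
  \sum_i v i = 1 -> (forall i, A (x i)) -> A (\sum_i v i *: x i).
Proof.
move=> cA.
have {}cA x1 x2 k : A x1 -> A x2 -> 0 <= k -> k <= 1 -> A (k *: x1 + (1 - k) *: x2).
  move=> Ax1 Ax2 k0 k1.
  have := cA x1 x2 (Itv01 k0 k1); rewrite !inE; exact.
elim: n v x => [|n IH] v x v0 v1 xA.
  by move: v1; rewrite big_ord0 => /esym/eqP; rewrite oner_eq0.
rewrite big_ord_recl in v1; rewrite big_ord_recl.
have s0 : 0 <= \sum_(i < n) v (lift ord0 i) by exact: sumr_ge0.
have [sE|sn0] := eqVneq (\sum_(i < n) v (lift ord0 i)) 0.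
  have v00 i : v (lift ord0 i) = 0.
    by apply/eqP; move/eqP: sE; rewrite psumr_eq0 // => /allP; apply; rewrite mem_index_enum.
  move: v1; rewrite sE addr0 => ->.
  by rewrite big1 => [|i _]; rewrite ?addr0 ?scale1r // v00 scale0r.
set s := \sum_(i < n) _ in v1 s0 sn0.
have sp : 0 < s by rewrite lt_def sn0.
have Ay : A (\sum_(i < n) (v (lift ord0 i) / s) *: x (lift ord0 i)).
  apply: IH => // [i|]; first by rewrite divr_ge0.
  by rewrite -mulr_suml divff.
have -> : \sum_(i < n) v (lift ord0 i) *: x (lift ord0 i) =
    s *: \sum_(i < n) (v (lift ord0 i) / s) *: x (lift ord0 i).
  by rewrite scaler_sumr; apply: eq_bigr => i _; rewrite scalerA mulrCA divff // mulr1.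
have sE : s = 1 - v ord0 by rewrite -v1 addrC addKr.
by rewrite {1}sE; apply: cA => //; rewrite -v1 lerDl.
Qed.

(* With [c = 1] the extra coordinate makes the weights of a linear
   combination of such vectors sum to one. *)
Definition coords (c : R) (u : H) : 'rV[R]_5 :=
  \row_i [:: c; qre u; qi u; qj u; qk u]`_i.

Lemma coordsD c d u v : coords (c + d) (u + v) = coords c u + coords d v.
Proof.
by apply/rowP => -[[|[|[|[|[|k]]]]] h]; rewrite !mxE.
Qed.

Lemma coordsZ k c u : coords (k * c) (k *: u) = k *: coords c u.
Proof.
by apply/rowP => -[[|[|[|[|[|i]]]]] h]; rewrite !mxE.
Qed.

Lemma coords_inj c d u v : coords c u = coords d v -> c = d /\ u = v.
Proof.
case: u v => [????] [????] /rowP E.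
have := E 0; have := E 1; have := E (inord 2); have := E (inord 3); have := E (inord 4).
by rewrite !mxE !inordK //= => -> -> -> -> ->.
Qed.

Lemma coords_sum n (w : 'I_n -> R) (x : 'I_n -> H) :
  \sum_k w k *: coords 1 (x k) = coords (\sum_k w k) (\sum_k w k *: x k).
Proof.
elim: n w x => [|n IH] w x.
  by rewrite !big_ord0; apply/rowP => -[[|[|[|[|[|i]]]]] h]; rewrite !mxE.
by rewrite !big_ord_recl IH coordsD -coordsZ mulr1.
Qed.

Lemma norm_coords0 u j : `|coords 0 u 0 j| <= `|u|.
Proof.
have le (a b : R) : 0 <= b -> a ^+ 2 <= b ^+ 2 -> `|a| <= b.
  by move=> b0 h; rewrite -(ler_pXn2r (n := 2)) ?nnegrE // real_normK ?num_real.
apply: le => //; rewrite sqr_normq mxE.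
have := (sqr_ge0 (qre u), sqr_ge0 (qi u), sqr_ge0 (qj u), sqr_ge0 (qk u)).
move=> [[[? ?] ?] ?].
by case: j => [[|[|[|[|[|i]]]]] h] //=; rewrite ?expr0n /=; lra.
Qed.

End Convexity.

(** * The partial sum as an exact convex combination of values of f *)

Theorem theorem6p3 (R : realType) (f g h : quaternion R -> quaternion R)
    (a b : nat -> quaternion R)
    (g_regular : slice_regular g) (h_regular : slice_regular h)
    (g_series : power_series_on_ball a g) (h_series : power_series_on_ball b h)
    (f_def : forall q, unit_ball q -> f q = g q + qconj (h q))
    (f_convex : convex_set (f @` unit_ball)) :
  forall m : nat, (1 <= m)%N ->
  exists r : R, is_radius m r /\
    forall q : quaternion R, ball 0 r q ->
      (f @` unit_ball) (power_sum a m q + qconj (power_sum b m q)).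
Proof.
move=> m m1; have [r0 [r0m r01 kpos]] := @radius_exists R m m1.
exists r0; split => // q; rewrite -ball_normE /= sub0r normrN => qr0.
(* A radius strictly between: r < [r0] bounds the kernel below by [delta], and |q| < r puts u = q /
   r in the unit ball. *)
pose r := (`|q| + r0) / 2.
have q0 := normr_ge0 q.
have r_gt0 : 0 < r by rewrite /r; lra.
have rr0 : r < r0 by rewrite /r; lra.
have qr : `|q| < r by rewrite /r; lra.
have [delta delta0 K] := kpos r r_gt0 rr0.
have K0 t : 0 <= trig_kernel m r t by exact: le_trans (ltW delta0) (K t).
pose u := r^-1 *: q.
have uq : r *: u = q by rewrite /u scalerA divff ?scale1r // gt_eqF.
have u1 : `|u| < 1.
  by rewrite /u normrZ gtr0_norm ?invr_gt0 // mulrC ltr_pdivrMr // mul1r.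
have [I [I_unit uI]] := imaginary_unit_comm u.
pose z N k := u * qcis I (grid_angle N k).
have zb N k : (0 < N)%N -> unit_ball (z N k).
  by move=> N0; apply/unit_ballP; rewrite normqM norm_qcis_grid // mulr1.
set S := power_sum a m q + _.
pose w N k := grid_weight m r N k.
pose err N := S - \sum_(k < N) w N k *: f (z N k).
have errE N : (0 < N)%N -> `|err N| <=
    `|\sum_(k < N) w N k *: g (z N k) - power_sum a m q| +
    `|\sum_(k < N) w N k *: h (z N k) - power_sum b m q|.
  (* Conjugation is real-linear and the weights are real, so one mean serves both series and the
     error splits. *)
  move=> N0; have -> : err N =
      - (\sum_(k < N) w N k *: g (z N k) - power_sum a m q) +
      qconj (- (\sum_(k < N) w N k *: h (z N k) - power_sum b m q)).
    rewrite !opprB qconjD /err /S.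
    have -> : qconj (- \sum_(k < N) w N k *: h (z N k)) =
        - \sum_(k < N) w N k *: qconj (h (z N k)).
      rewrite -sumrN qconj_sum -sumrN; apply: eq_bigr => k _.
      by rewrite -!scaleNr qconjZ.
    rewrite addrACA -opprD -big_split /=; congr (_ + _).
    congr (- _); apply: eq_bigr => k _; rewrite f_def ?scalerDr //.
    exact: zb.
  by apply: le_trans (ler_normD _ _) _; rewrite normq_conj !normrN.
(* The extra coordinate 1 forces the corrected weights to sum to 1 again. *)
have [N [v [v0 vE]]] : exists N (v : 'I_N -> R), (forall k, 0 <= v k) /\
    coords 1 S = \sum_k v k *: coords 1 (f (z N k)).
  apply: (exact_weights (fun N k => coords 1 (f (z N k))) _ w delta delta0).
  - by move=> N l k; rewrite /z grid_angle_refine.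
  - move=> N k N0; rewrite /w /grid_weight mulrC divfK ?pnatr_eq0 -?lt0n //.
  - move=> e e0; have e20 : 0 < e / 2 by rewrite divr_gt0.
    have [N1 H1] := grid_mean_error _ I_unit _ _ _ m r g_series uI u1 K0 _ e20.
    have [N2 H2] := grid_mean_error _ I_unit _ _ _ m r h_series uI u1 K0 _ e20.
    exists (N1 + N2 + m.*2).+1 => N j NN.
    rewrite coords_sum.
    (* The grid weights sum to 1, so the error has extra coordinate 0 and is controlled by
       [err N]. *)
    rewrite (grid_weight_sum _ I_unit); last by lia.
    rewrite -scaleN1r -coordsZ mulr1 -coordsD subrr scaleN1r.
    apply: (@le_trans _ _ (N%:R * `|err N|)).
      by rewrite ler_wpM2l // norm_coords0.
    rewrite [leRHS]splitr.
    apply: le_trans (lerD (H1 N _) (H2 N _)); [|lia|lia].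
    by rewrite -mulrDr ler_wpM2l // uq errE //; lia.
move: vE; rewrite coords_sum => /coords_inj[v1 ->].
apply: (convex_set_sum _ _ _ v (fun k => f (z N k)) f_convex v0 (esym v1)) => k.
exists (z N k) => //; apply: zb.
exact: leq_ltn_trans (ltn_ord k).
Qed.
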